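(* Let $H$ be a finite simple non-abelian group, let $I$ be an infinite index set, and let $G=H^{(I)}$ be equipped with the discrete topology. Then $G$ is Chu reflexive (that is, $G$ satisfies Chu duality), and for every $n\in\mathbb{N}$ the space $(\widehat{G}_n,t_p(G))$ is a discrete topological space.
   Context: $H^{(I)}$ denotes the direct sum of $|I|$ copies of $H$, i.e. the subgroup of $H^I$ of all $(x_i)_{i\in I}$ with $x_i=e$ for all but finitely many $i$. For $n\ge 1$, $\mathbb{U}(n)$ is the compact group of unitary $n\times n$ complex matrices. For a (Hausdorff) topological group $G$, $\mathrm{rep}_n(G)$ is the set of all continuous homomorphisms $G\to\mathbb{U}(n)$ with the compact-open topology (for discrete $G$ this is the topology of pointwise convergence on $G$), and $\mathrm{rep}(G)=\bigsqcup_{n\ge 1}\mathrm{rep}_n(G)$ is their topological sum (the Chu dual). $\mathrm{irrep}_n(G)\subseteq \mathrm{rep}_n(G)$ is the subspace of irreducible representations. Two representations $\rho,\psi\in\mathrm{rep}_n(G)$ are equivalent if there is $M\in\mathbb{U}(n)$ with $\rho(x)=M^{-1}\psi(x)M$ for all $x\in G$. $\widehat{G}_n=\mathrm{irrep}_n(G)/{\sim}$ is the set of equivalence classes of irreducible $n$-dimensional representations. Here $t_p(G)$ is the topology of pointwise convergence on $G$, i.e. the quotient topology on $\widehat G_n$ induced from $\mathrm{irrep}_n(G)$ with the topology of pointwise convergence on $G$ (it coincides with the Fell topology on $\widehat G_n$ since $G$ is discrete). Let $\mathbb{U}=\bigsqcup_{n\ge 1}\mathbb{U}(n)$ (topological sum).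 A quasi-representation of $\mathrm{rep}(G)$ is a continuous map $p:\mathrm{rep}(G)\to\mathbb{U}$ such that $p(\mathrm{rep}_n(G))\subseteq\mathbb{U}(n)$ for all $n$, $p(D\oplus D')=p(D)\oplus p(D')$, $p(D\otimes D')=p(D)\otimes p(D')$ for all $D,D'\in\mathrm{rep}(G)$, and $p(M^{-1}DM)=M^{-1}p(D)M$ for all $D\in\mathrm{rep}_n(G)$, $M\in\mathbb{U}(n)$. The Chu bidual group (Chu quasi-dual) $G^{xx}$ is the set of all quasi-representations with pointwise multiplication and the compact-open topology on $\mathrm{rep}(G)$; it is a topological group. The evaluation map $\mathcal{E}_G:G\to G^{xx}$ is $\mathcal{E}_G(g)(D)=D(g)$. $G$ is Chu reflexive (satisfies Chu duality) if $\mathcal{E}_G$ is an isomorphism of topological groups. *)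

(* Defs.v *)
From HB Require Import structures.
From mathcomp Require Import all_boot all_order all_algebra all_fingroup.
From mathcomp Require Import gseries spectral generic_quotient.
From mathcomp Require Import all_classical reals topology normedtype.
From mathcomp Require Import complex mxtens.

Set Implicit Arguments.
Unset Strict Implicit.
Unset Printing Implicit Defensive.

Import Order.TTheory GRing.Theory Num.Theory numFieldNormedType.Exports.

Local Open Scope classical_set_scope.
Local Open Scope ring_scope.

HB.mixin Record isTopologicalGroup G & monoid.Group G & Topological G := {
  mulg_cts : continuous (fun xy : G * G => (xy.1 * xy.2)%g);
  invg_cts : continuous (fun x : G => x^-1%g)
}.

#[short(type="topologicalGroupType")]
HB.structure Definition TopologicalGroup :=
  {G of isTopologicalGroup G & monoid.Group G & Topological G}.

Definition topgroup_iso (G H : topologicalGroupType) (f : G -> H) :=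
  {morph f : x y / (x * y)%g} /\
  exists2 g : H -> G, cancel f g /\ cancel g f & continuous f /\ continuous g.

Section discrete_group.
Variable G : groupType.

HB.instance Definition _ := Group.copy (discrete_topology G) G.

Let mul_cts : continuous
  (fun xy : discrete_topology G * discrete_topology G => (xy.1 * xy.2)%g).
Proof.
move=> [x y] A /nbhs_singleton /= Axy.
exists ([set x], [set y]); first by split; exact: discrete_set1.
by move=> [x' y'] /= [-> ->].
Qed.

Let inv_cts : continuous (fun x : discrete_topology G => x^-1%g).
Proof.
move=> x A /nbhs_singleton /= Ax.
by apply: (filterS _ (discrete_set1 x)) => y ->.
Qed.

HB.instance Definition _ :=
  isTopologicalGroup.Build (discrete_topology G) mul_cts inv_cts.
End discrete_group.

Section direct_sum.
Variables (H : groupType) (I : Type).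

Definition direct_sum :=
  set_type [set x : I -> H | finite_set [set i | x i <> 1%g]].

HB.instance Definition _ := Choice.on direct_sum.

Lemma direct_sumP (x : direct_sum) : finite_set [set i | val x i <> 1%g].
Proof. exact: set_mem (valP x). Qed.

Definition DirectSum (x : I -> H)
    (fx : finite_set [set i | x i <> 1%g]) : direct_sum :=
  exist _ x (mem_set fx).

Let one_subproof : finite_set [set i : I | (fun=> 1 : H)%g i <> 1%g].
Proof.
suff -> : [set i : I | (fun=> 1 : H)%g i <> 1%g] = set0 by [].
by rewrite -subset0 => i.
Qed.

Let mul_subproof (x y : direct_sum) :
  finite_set [set i | (val x i * val y i)%g <> 1%g].
Proof.
apply: (@sub_finite_set _ _
    ([set i | val x i <> 1%g] `|` [set i | val y i <> 1%g])).
  move=> i /= xyi; have [xi|] := pselect (val x i = 1%g); last by left.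
  by right=> yi; apply: xyi; rewrite xi yi mulg1.
by rewrite finite_setU; split; exact: direct_sumP.
Qed.

Let inv_subproof (x : direct_sum) : finite_set [set i | (val x i)^-1%g <> 1%g].
Proof.
apply: sub_finite_set (direct_sumP x) => i /= xi xi1.
by apply: xi; rewrite xi1 invg1.
Qed.

Let one := DirectSum one_subproof.
Let mul x y := DirectSum (mul_subproof x y).
Let inv x := DirectSum (inv_subproof x).

Let mulA : associative mul.
Proof. by move=> x y z; apply/val_inj/funext => i /=; rewrite mulgA. Qed.
Let mul1 : left_id one mul.
Proof. by move=> x; apply/val_inj/funext => i /=; rewrite mul1g. Qed.
Let mulr1 : right_id one mul.
Proof. by move=> x; apply/val_inj/funext => i /=; rewrite mulg1. Qed.
Let mulV : left_inverse one inv mul.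
Proof. by move=> x; apply/val_inj/funext => i /=; rewrite mulVg. Qed.
Let mulrV : right_inverse one inv mul.
Proof. by move=> x; apply/val_inj/funext => i /=; rewrite mulgV. Qed.

HB.instance Definition _ := isGroup.Build direct_sum mulA mul1 mulr1 mulV mulrV.
End direct_sum.

(* R[i] carries the topology of the modulus. *)
HB.instance Definition _ (R : realType) := NormedModule.copy R[i] R[i]^o.


Lemma cvg_mxP (T : topologicalType) m n (S : Type) (F : set_system S)
    (f : S -> 'M[T]_(m, n)) (A : 'M[T]_(m, n)) : Filter F ->
  f @ F --> A <-> forall i j, (fun s => f s i j) @ F --> A i j.
Proof.
move=> FF; split=> [fA i j B Bij|fA B [P PA PB]].
  apply: (fA [set N | B (N i j)]).
  exists (fun i' j' => [set z | i' = i -> j' = j -> B z]).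
    move=> i' j'; have [->|ni] := eqVneq i' i; last first.
      by apply: nearW => z ii; rewrite ii eqxx in ni.
    have [->|nj] := eqVneq j' j; last first.
      by apply: nearW => z _ jj; rewrite jj eqxx in nj.
    by apply: (filterS _ Bij) => z Bz.
  by move=> N /(_ i j) /= BN; exact: BN.
suff : \forall s \near F, forall i j, P i j (f s i j).
  by apply: filterS => s Ps; exact: PB.
apply: filter_forall => i; apply: filter_forall => j.
exact: (fA i j _ (PA i j)).
Qed.

Section unitary.
Variables (R : realType) (n : nat).

Definition unitary := set_type [set M : 'M[R[i]]_n | M \is unitarymx].

HB.instance Definition _ := Uniform.on unitary.

Definition Unitary (M : 'M[R[i]]_n) (uM : M \is unitarymx) : unitary :=
  exist _ M (mem_set uM).

Lemma unitaryP (M : unitary) : val M \is unitarymx.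
Proof. exact: set_mem (valP M). Qed.

Lemma cvg_unitaryP (S : Type) (F : set_system S) (f : S -> unitary)
    (M : unitary) : Filter F ->
  f @ F --> M <-> forall i j, (fun s => val (f s) i j) @ F --> val M i j.
Proof.
move=> FF; rewrite -cvg_mxP; split=> [fM|fM].
  apply: (@cvg_trans _ (val @ (f @ F))) => //.
  apply: cvg_trans; first exact: (cvg_app val fM).
  exact: (@initial_continuous unitary 'M[R[i]]_n val M).
move=> B [_ [[C oC <-] /= CM] CB]; apply: (filterS CB).
by apply: fM; exact: open_nbhs_nbhs.
Qed.

Let one_subproof : (1%:M : 'M[R[i]]_n) \is unitarymx.
Proof. by apply/unitarymxP; rewrite trmx1 map_mx1 mulmx1. Qed.

Let inv_subproof (M : unitary) : map_mx Num.conj (val M)^T \is unitarymx.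
Proof. by rewrite trmxC_unitary unitaryP. Qed.

Let one : unitary := Unitary one_subproof.
Let mul (M N : unitary) : unitary :=
  Unitary (mul_unitarymx (unitaryP M) (unitaryP N)).
Let inv (M : unitary) : unitary := Unitary (inv_subproof M).

Let mulA : associative mul.
Proof. by move=> x y z; apply/val_inj; rewrite /= mulmxA. Qed.
Let mul1 : left_id one mul.
Proof. by move=> x; apply/val_inj; rewrite /= mul1mx. Qed.
Let mulr1 : right_id one mul.
Proof. by move=> x; apply/val_inj; rewrite /= mulmx1. Qed.
Let mulrV : right_inverse one inv mul.
Proof. by move=> x; apply/val_inj/unitarymxP/unitaryP. Qed.
Let mulV : left_inverse one inv mul.
Proof. by move=> x; apply/val_inj/mulmx1C/unitarymxP/unitaryP. Qed.

HB.instance Definition _ := isGroup.Build unitary mulA mul1 mulr1 mulV mulrV.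

Lemma val_unitaryM (M N : unitary) : val (M * N)%g = val M *m val N.
Proof. by []. Qed.

Lemma val_unitaryV (M : unitary) : val (M^-1)%g = map_mx Num.conj (val M)^T.
Proof. by []. Qed.

Let mul_cts : continuous (fun xy : unitary * unitary => (xy.1 * xy.2)%g).
Proof.
move=> [M N]; apply/cvg_unitaryP => i j; rewrite val_unitaryM mxE.
under eq_fun do rewrite val_unitaryM mxE.
apply: cvg_big => [|k _]; first exact: add_continuous.
apply: cvgM.
- have : (fun x : unitary * unitary => x.1) @ (M, N) --> M by exact: cvg_fst.
  by move/cvg_unitaryP; exact.
- have : (fun x : unitary * unitary => x.2) @ (M, N) --> N by exact: cvg_snd.
  by move/cvg_unitaryP; exact.
Qed.

Let inv_cts : continuous (fun x : unitary => x^-1%g).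
Proof.
move=> M.
apply: (iffRL (@cvg_unitaryP unitary (nbhs M) _ (M^-1)%g _)) => i j.
rewrite val_unitaryV !mxE.
under eq_fun do rewrite val_unitaryV !mxE.
have [+ _] := @cvg_unitaryP unitary (nbhs M) (fun x => x) M _.
move=> /(_ (@cvg_id _ (nbhs M)))/(_ j i) Mji.
apply: (@cvg_comp _ _ _ _ Num.conj _ _ _ Mji).
apply/cvgrPdist_lt => e e0; near=> z.
by rewrite -rmorphB norm_conjC; near: z; exact: cvgr_dist_lt.
Unshelve. all: by end_near. Qed.

HB.instance Definition _ := isTopologicalGroup.Build unitary mul_cts inv_cts.

End unitary.

Section sums.
Variable R : realType.
Local Notation U := (unitary R).

Let dsum_subproof m n (A : U m) (B : U n) :
  block_mx (val A) 0 0 (val B) \is unitarymx.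
Proof.
apply/unitarymxP; rewrite tr_block_mx map_block_mx mulmx_block.
rewrite !trmx0 !map_mx0 !mulmx0 !mul0mx !addr0 !add0r.
by rewrite !(unitarymxP (unitaryP _)) -scalar_mx_block.
Qed.

Definition dsumU m n (A : U m) (B : U n) : U (m + n) :=
  Unitary (dsum_subproof A B).

Let tensmx1 m n :
  tensmx (1%:M : 'M[R[i]]_m) (1%:M : 'M[R[i]]_n) = 1%:M.
Proof.
apply/matrixP => i j.
case: (mxtens_indexP i) (mxtens_indexP j) => i1 i2 [j1 j2].
rewrite tensmxE !mxE (can_eq (@mxtens_indexK _ _)) xpair_eqE.
by rewrite -natrM mulnb.
Qed.

Let tens_subproof m n (A : U m) (B : U n) :
  tensmx (val A) (val B) \is unitarymx.
Proof.
apply/unitarymxP; rewrite trmx_tens.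
have -> : map_mx Num.conj (tensmx (val A)^T (val B)^T) =
    tensmx (map_mx Num.conj (val A)^T) (map_mx Num.conj (val B)^T).
  by apply/matrixP => i j; rewrite !mxE rmorphM.
by rewrite tensmx_mul !(unitarymxP (unitaryP _)) tensmx1.
Qed.

Definition tensU m n (A : U m) (B : U n) : U (m * n) :=
  Unitary (tens_subproof A B).

Lemma dsumUM m n (A A' : U m) (B B' : U n) :
  dsumU (A * A')%g (B * B')%g = (dsumU A B * dsumU A' B')%g.
Proof.
apply/val_inj; rewrite /= mulmx_block.
by rewrite !mulmx0 !mul0mx !addr0 !add0r.
Qed.

Lemma tensUM m n (A A' : U m) (B B' : U n) :
  tensU (A * A')%g (B * B')%g = (tensU A B * tensU A' B')%g.
Proof. by apply/val_inj; rewrite /= tensmx_mul. Qed.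

Lemma dsumU1 m n : dsumU 1%g 1%g = 1%g :> U (m + n).
Proof. by apply/val_inj; rewrite /= -scalar_mx_block. Qed.

Lemma tensU1 m n : tensU 1%g 1%g = 1%g :> U (m * n).
Proof. by apply/val_inj; exact: tensmx1. Qed.

Lemma dsumUV m n (A : U m) (B : U n) :
  dsumU A^-1%g B^-1%g = (dsumU A B)^-1%g.
Proof.
apply/val_inj => /=.
by rewrite tr_block_mx map_block_mx !trmx0 !map_mx0.
Qed.

Lemma tensUV m n (A : U m) (B : U n) :
  tensU A^-1%g B^-1%g = (tensU A B)^-1%g.
Proof. by apply/val_inj/matrixP => i j; rewrite !mxE rmorphM. Qed.

Lemma cvg_dsumU m n (S : Type) (F : set_system S) (f : S -> U m) (g : S -> U n)
    (A : U m) (B : U n) : Filter F ->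
  f @ F --> A -> g @ F --> B -> (fun s => dsumU (f s) (g s)) @ F --> dsumU A B.
Proof.
move=> FF /cvg_unitaryP fA /cvg_unitaryP gB; apply/cvg_unitaryP => i j /=.
case: (split_ordP i) => i' ->; case: (split_ordP j) => j' ->.
- by rewrite block_mxEul; under eq_fun do rewrite block_mxEul; exact: fA.
- by rewrite block_mxEur; under eq_fun do rewrite block_mxEur; exact: cvg_cst.
- by rewrite block_mxEdl; under eq_fun do rewrite block_mxEdl; exact: cvg_cst.
- by rewrite block_mxEdr; under eq_fun do rewrite block_mxEdr; exact: gB.
Qed.

Lemma cvg_tensU m n (S : Type) (F : set_system S) (f : S -> U m) (g : S -> U n)
    (A : U m) (B : U n) : Filter F ->
  f @ F --> A -> g @ F --> B -> (fun s => tensU (f s) (g s)) @ F --> tensU A B.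
Proof.
move=> FF /cvg_unitaryP fA /cvg_unitaryP gB; apply/cvg_unitaryP => i j /=.
by rewrite mxE; under eq_fun do rewrite mxE; apply: cvgM; [exact: fA|exact: gB].
Qed.

End sums.

Section representations.
Variables (R : realType) (G : topologicalGroupType).
Local Notation U := (unitary R).

Definition is_rep n (f : G -> U n) :=
  continuous f /\ {morph f : x y / (x * y)%g}.

Definition rep n := set_type [set f : {compact-open, G -> U n} | is_rep f].

HB.instance Definition _ n := Topological.on (rep n).

Definition rep_fun n (D : rep n) : G -> U n := val D.
Coercion rep_fun : rep >-> Funclass.

Definition Rep n (f : G -> U n) (rf : is_rep f) : rep n :=
  exist _ (f : {compact-open, G -> U n}) (mem_set rf).

Lemma repP n (D : rep n) : is_rep D.
Proof. exact: set_mem (valP D). Qed.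

Let dsum_subproof m n (D : rep m) (D' : rep n) :
  is_rep (fun x => dsumU (D x) (D' x)).
Proof.
have [[cD mD] [cD' mD']] := (repP D, repP D').
split=> [x|x y]; first by apply: cvg_dsumU; [exact: cD|exact: cD'].
by rewrite mD mD' dsumUM.
Qed.

Definition dsum m n (D : rep m) (D' : rep n) : rep (m + n) :=
  Rep (dsum_subproof D D').

Let tens_subproof m n (D : rep m) (D' : rep n) :
  is_rep (fun x => tensU (D x) (D' x)).
Proof.
have [[cD mD] [cD' mD']] := (repP D, repP D').
split=> [x|x y]; first by apply: cvg_tensU; [exact: cD|exact: cD'].
by rewrite mD mD' tensUM.
Qed.

Definition tens m n (D : rep m) (D' : rep n) : rep (m * n) :=
  Rep (tens_subproof D D').

Let conj_subproof n (D : rep n) (M : U n) : is_rep (fun x => D x ^ M)%g.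
Proof.
have [cD mD] := repP D; split=> [x|x y]; last by rewrite mD conjMg.
have mulc (f g : G -> U n) : f @ x --> f x -> g @ x --> g x ->
    (fun y => f y * g y)%g @ x --> (f x * g x)%g.
  by move=> fx gx; apply: (cvg_comp2 fx gx (mulg_cts (f x, g x))).
apply: (mulc (fun=> M^-1)%g (fun y => D y * M)%g); first exact: cvg_cst.
by apply: mulc; [exact: cD|exact: cvg_cst].
Qed.

Definition conj_rep n (D : rep n) (M : U n) : rep n := Rep (conj_subproof D M).

(* The index n of a summand stands for the dimension n.+1, so that exactly the
   positive dimensions occur. *)
Definition chu_dual := {n : nat & rep n.+1}.
Definition unitary_sum := {n : nat & U n.+1}.

HB.instance Definition _ := Topological.on chu_dual.
HB.instance Definition _ := Topological.on unitary_sum.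

(* A map chu_dual -> unitary_sum preserving dimensions is the same thing as a
   family of maps rep n.+1 -> U n.+1. *)
Definition sum_fun (p : forall n, rep n.+1 -> U n.+1) :
    {compact-open, chu_dual -> unitary_sum} :=
  fun D => existT _ (projT1 D) (p (projT1 D) (projT2 D)).

Definition is_quasi_rep (p : forall n, rep n.+1 -> U n.+1) := [/\
  continuous (sum_fun p),
  forall m n (D : rep m.+1) (D' : rep n.+1),
    p (m.+1 + n.+1).-1 (dsum D D') = dsumU (p m D) (p n D'),
  forall m n (D : rep m.+1) (D' : rep n.+1),
    p (m.+1 * n.+1).-1 (tens D D') = tensU (p m D) (p n D') &
  forall n (D : rep n.+1) (M : U n.+1), p n (conj_rep D M) = (p n D ^ M)%g].

Let sum_nbhs n (M : U n.+1) (B : set (U n.+1)) : nbhs M B ->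
  nbhs (existT _ n M : unitary_sum) (existT (fun n => U n.+1) n @` B).
Proof. exact: (@existT_nbhs nat (fun n => U n.+1)). Qed.

Lemma sum_fun_continuousP (p : forall n, rep n.+1 -> U n.+1) :
  continuous (sum_fun p) <-> forall n, continuous (p n).
Proof.
split=> [cp n D B pB|cp [n D] B pB].
  have h : \forall D' \near D,
      (existT (fun n => U n.+1) n @` B) (sum_fun p (existT _ n D')).
    exact: (cp (existT _ n D) _ (sum_nbhs pB)).
  apply: (@filterS _ (nbhs D) _ _ _ _ h) => D' [b Bb].
  by move/(@existT_inj2 _ (fun n => U n.+1)) => /= bp; rewrite /= -bp.
exact: (cp n D _ pB).
Qed.

(* The topology is the compact-open one, through sum_fun. *)
Definition chu_bidual := set_type [set p | is_quasi_rep p].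

HB.instance Definition _ := Choice.on chu_bidual.

Definition bidual_fun (p : chu_bidual) := val p.
Coercion bidual_fun : chu_bidual >-> Funclass.

HB.instance Definition _ := Topological.copy chu_bidual
  (initial_topology (fun p : chu_bidual => sum_fun p)).

Definition QuasiRep p (qp : is_quasi_rep p) : chu_bidual :=
  exist _ p (mem_set qp).

Lemma quasi_repP (p : chu_bidual) : is_quasi_rep p.
Proof. exact: set_mem (valP p). Qed.

Let one_subproof : is_quasi_rep (fun n _ => 1%g).
Proof.
split.
- by apply/sum_fun_continuousP => n D B; move/nbhs_singleton => B1; exact: (@filterE _ (nbhs D)).
- by move=> m n D D'; exact: (esym (@dsumU1 R m.+1 n.+1)).
- by move=> m n D D'; exact: (esym (@tensU1 R m.+1 n.+1)).
- by move=> n D M; rewrite conj1g.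
Qed.

Let mul_subproof (p q : chu_bidual) :
  is_quasi_rep (fun n D => p n D * q n D)%g.
Proof.
have [/sum_fun_continuousP cp pD pT pJ] := quasi_repP p.
have [/sum_fun_continuousP cq qD qT qJ] := quasi_repP q.
split.
- apply/sum_fun_continuousP => n D.
  exact: (cvg_comp2 (cp n D) (cq n D) (mulg_cts (p n D, q n D))).
- by move=> m n D D'; rewrite pD qD dsumUM.
- by move=> m n D D'; rewrite pT qT tensUM.
- by move=> n D M; rewrite pJ qJ conjMg.
Qed.

Let inv_subproof (p : chu_bidual) : is_quasi_rep (fun n D => (p n D)^-1)%g.
Proof.
have [/sum_fun_continuousP cp pD pT pJ] := quasi_repP p.
split.
- apply/sum_fun_continuousP => n D.
  apply: (@continuous_comp _ _ _ (p n) (fun x : U n.+1 => x^-1%g)).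
    exact: cp.
  exact: invg_cts.
- by move=> m n D D'; rewrite pD dsumUV.
- by move=> m n D D'; rewrite pT tensUV.
- by move=> n D M; rewrite pJ conjVg.
Qed.

Let one : chu_bidual := QuasiRep one_subproof.
Let mul (p q : chu_bidual) : chu_bidual := QuasiRep (mul_subproof p q).
Let inv (p : chu_bidual) : chu_bidual := QuasiRep (inv_subproof p).

Let bidual_eq (p q : chu_bidual) : (forall n D, p n D = q n D) -> p = q.
Proof.
by move=> pq; apply/val_inj/functional_extensionality_dep => n; apply/funext.
Qed.

Let mulA : associative mul.
Proof. by move=> p q r; apply: bidual_eq => n D; exact: mulgA. Qed.
Let mul1 : left_id one mul.
Proof. by move=> p; apply: bidual_eq => n D; exact: mul1g. Qed.
Let mulr1 : right_id one mul.
Proof. by move=> p; apply: bidual_eq => n D; exact: mulg1. Qed.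
Let mulV : left_inverse one inv mul.
Proof. by move=> p; apply: bidual_eq => n D; exact: mulVg. Qed.
Let mulrV : right_inverse one inv mul.
Proof. by move=> p; apply: bidual_eq => n D; exact: mulgV. Qed.

HB.instance Definition _ := isGroup.Build chu_bidual mulA mul1 mulr1 mulV mulrV.

Let sum_fun_cts (p : chu_bidual) : continuous (sum_fun p).
Proof. by have [] := quasi_repP p. Qed.

Let sum_fun_nbhs (p : chu_bidual) K O :
  compact K -> open O -> sum_fun p @` K `<=` O ->
  nbhs p [set q : chu_bidual | sum_fun q @` K `<=` O].
Proof.
move=> cK oO pKO.
have := @initial_continuous chu_bidual {compact-open, chu_dual -> unitary_sum}
  (fun p : chu_bidual => sum_fun p) p
  [set f : {compact-open, chu_dual -> unitary_sum} | f @` K `<=` O].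
by apply; apply: open_nbhs_nbhs; split => //; exact: compact_open_open.
Qed.

Let existT_closed n (A : set (U n.+1)) :
  closed A -> closed (existT (fun n => U n.+1) n @` A).
Proof.
move=> cA; rewrite -openC; apply/sigT_openP => m.
have [mn|mn] := eqVneq m n.
  subst m; rewrite (_ : _ @^-1` _ = ~` A); first by rewrite openC.
  apply/seteqP; split => M /=; first by move=> h AM; apply: h; exists M.
  by move=> h [N AN /(@existT_inj2 _ (fun n => U n.+1)) NM]; apply: h; rewrite -NM.
rewrite (_ : _ @^-1` _ = setT); first exact: openT.
apply/seteqP; split => // M _ [N _ /(congr1 (@projT1 _ _)) /= nm].
by rewrite nm eqxx in mn.
Qed.

Let mul_cts : continuous (fun pq : chu_bidual * chu_bidual => pq.1 * pq.2)%g.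
Proof.
apply: (@continuous_comp_initial _ _ _ (fun p : chu_bidual => sum_fun p)).
set f := _ \o _.
suff cf (p q : chu_bidual) : f @ (p, q) --> f (p, q) by case=> p q; exact: cf.
apply: (iffRL (@compact_open_cvgP _ _ (f @ (p, q)) (f (p, q)) _)).
move=> K O cK oO pqKO.
have nK : near_covering K by exact/compact_near_coveringP.
have := nK _ (nbhs (p, q)) (fun pq D => K D -> O (f pq D)) _.
have loc D : K D ->
    \forall D' \near D & pq \near (p, q), K D' -> O (f pq D').
  case: D => n d KD.
  pose E (X : set (U n.+1)) := existT (fun n => U n.+1) n @` X.
  have OD : nbhs (p n d * q n d)%g (existT (fun n => U n.+1) n @^-1` O).
    apply: open_nbhs_nbhs; split; first by move/sigT_openP: oO; apply.
    by apply: pqKO; exists (existT _ n d).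
  have [[A B] /= [nA nB] AB] := mulg_cts (p n d, q n d) _ OD.
  have [A0 nA0 clA] := @uniform_regular (U n.+1) (p n d) _ (nbhs_interior nA).
  have [B0 nB0 clB] := @uniform_regular (U n.+1) (q n d) _ (nbhs_interior nB).
  pose C := K `&` (sum_fun p @^-1` E (closure A0) `&`
                   sum_fun q @^-1` E (closure B0)).
  have cC : compact C.
    apply: compact_closedI => //; apply: closedI; apply: preimage_closed.
    - by move=> ? _; exact: sum_fun_cts.
    - exact/existT_closed/closed_closure.
    - by move=> ? _; exact: sum_fun_cts.
    - exact/existT_closed/closed_closure.
  have oE X : open (E X^°).
    exact: (@existT_open_map nat (fun n => U n.+1) n _ (open_interior X)).
  have Wp : nbhs p [set p' : chu_bidual | sum_fun p' @` C `<=` E A^°].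
    apply: sum_fun_nbhs => // _ [D' [_ [[M AM <-] _]] <-].
    by exists M => //; exact: clA.
  have Wq : nbhs q [set q' : chu_bidual | sum_fun q' @` C `<=` E B^°].
    apply: sum_fun_nbhs => // _ [D' [_ [_ [M BM <-]]] <-].
    by exists M => //; exact: clB.
  have Np := @sum_fun_cts p (existT _ n d) _ (sum_nbhs nA0).
  have Nq := @sum_fun_cts q (existT _ n d) _ (sum_nbhs nB0).
  exists ((sum_fun p @^-1` E A0) `&` (sum_fun q @^-1` E B0),
    [set p' : chu_bidual | sum_fun p' @` C `<=` E A^°] `*`
    [set q' : chu_bidual | sum_fun q' @` C `<=` E B^°]) => /=.
    split; first exact: filterI.
    by exists ([set p' : chu_bidual | sum_fun p' @` C `<=` E A^°],
      [set q' : chu_bidual | sum_fun q' @` C `<=` E B^°]).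
  move=> [D' [p' q']] /= [[pD' qD'] [p'C q'C]] KD'.
  have CD' : C D'.
    split=> //; split.
      by case: pD' => M AM pM; exists M => //; exact: subset_closure.
    by case: qD' => M BM qM; exists M => //; exact: subset_closure.
  have [|M AM pM] := p'C (sum_fun p' D'); first by exists D'.
  have [|N BN qN] := q'C (sum_fun q' D'); first by exists D'.
  case: D' {pD' qD' KD' CD'} pM qN => m d' /= pM qN.
  have /= mn : n = m := congr1 (@projT1 _ _) pM.
  subst m.
  move/(@existT_inj2 _ (fun n => U n.+1)): pM => /= pM.
  move/(@existT_inj2 _ (fun n => U n.+1)): qN => /= qN.
  have /= := AB (M, N) (conj (interior_subset AM) (interior_subset BN)).
  by rewrite pM qN; exact.
move=> /(_ _ loc) KO; apply: filterS KO => pq KO _ [D KD <-].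
exact: KO.
Qed.

Let inv_cts : continuous (fun p : chu_bidual => p^-1)%g.
Proof.
apply: (@continuous_comp_initial _ _ _ (fun p : chu_bidual => sum_fun p)).
set f := _ \o _.
suff cf (p : chu_bidual) : f @ p --> f p by move=> p; exact: cf.
apply: (iffRL (@compact_open_cvgP _ _ (f @ nbhs p) (f p)
  (@fmap_filter _ _ f (nbhs p) (nbhs_filter p)))) => K O cK oO pKO.
pose iota (M : unitary_sum) : unitary_sum :=
  existT _ (projT1 M) (projT2 M)^-1%g.
have ciota : continuous iota.
  case=> n M B nB.
  exact: (@invg_cts (U n.+1) M _ nB).
have oO' : open (iota @^-1` O).
  by apply: open_comp => // M _; exact: ciota.
have oK : sum_fun p @` K `<=` iota @^-1` O.
  by move=> _ [D KD <-]; apply: pKO; exists D.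
apply: (@filterS _ (nbhs p) _ _ _ _ (@sum_fun_nbhs p K _ cK oO' oK)).
by move=> q qK _ [D KD <-]; apply: (qK (sum_fun q D)); exists D.
Qed.

HB.instance Definition _ :=
  isTopologicalGroup.Build chu_bidual mul_cts inv_cts.

Let eval_subproof (g : G) : is_quasi_rep (fun n D => D g).
Proof.
split=> //; apply/sum_fun_continuousP => n D.
move=> B; rewrite nbhsE => -[O [oO Og] OB].
have nO : nbhs (val D : {compact-open, G -> U n.+1})
    [set f : {compact-open, G -> U n.+1} | f @` [set g] `<=` O].
  apply: open_nbhs_nbhs; split; last by move=> _ [_ -> <-].
  exact: (compact_open_open (compact_set1 (x := g)) oO).
apply: (@filterS _ (nbhs D) _ _ _ _
  (@initial_continuous (rep n.+1) {compact-open, G -> U n.+1} val D _ nO)).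
by move=> D' /= DO; apply/OB/DO; exists g.
Qed.

Definition chu_eval (g : G) : chu_bidual := QuasiRep (eval_subproof g).

Definition chu_reflexive := topgroup_iso chu_eval.

(* Irreducible representations have positive dimension, so irrep_ptws 0 is
   empty. *)
Definition irreducible n (f : G -> U n) := (0 < n)%N /\
  forall W : {vspace 'cV[R[i]]_n},
    (forall x w, w \in W -> val (f x) *m w \in W) -> W = 0%VS \/ W = fullv.

Definition irrep_ptws n :=
  set_type [set f : {ptws G -> U n} | is_rep f /\ irreducible f].

HB.instance Definition _ n := Topological.on (irrep_ptws n).

Definition rep_equiv n (f g : G -> U n) :=
  exists M : U n, forall x, f x = (g x ^ M)%g.

Let equivb n (D D' : irrep_ptws n) := `[< rep_equiv (val D) (val D') >].

Let equiv_refl n : reflexive (@equivb n).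
Proof. by move=> D; apply/asboolP; exists 1%g => x; rewrite conjg1. Qed.

Let equiv_sym n : symmetric (@equivb n).
Proof.
move=> D D'; apply/asboolP/asboolP => -[M DM]; exists M^-1%g => x.
  by rewrite DM conjgK.
by rewrite DM conjgK.
Qed.

Let equiv_trans n : transitive (@equivb n).
Proof.
move=> D2 D1 D3 /asboolP[M DM] /asboolP[N DN]; apply/asboolP.
by exists (N * M)%g => x; rewrite DM DN conjgM.
Qed.

Canonical irrep_equiv n :=
  EquivRel (@equivb n) (@equiv_refl n) (@equiv_sym n) (@equiv_trans n).

Definition dual_ptws n := quotient_topology {eq_quot (irrep_equiv n)}%qT.

HB.instance Definition _ n := Topological.on (dual_ptws n).

End representations.

(* Main.v *)
(* A representation D of G of dimension n is trivial on all but at most n^2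
   coordinates, because noncommuting elements of the images of distinct
   coordinate subgroups are linearly independent matrices.

   If D0 is irreducible and D is pointwise close to D0, averaging D(x) D0(x)^-1
   over the support of D0 gives a nonzero intertwiner, unitary up to a scalar by
   Schur's lemma. The remaining coordinates commute with an irreducible set of
   matrices and act by scalars, hence trivially. So D is equivalent to D0, and
   the equivalence class of D0 is open.

   Let lam_i be the regular representation of H composed with the i-th
   projection. Tensoring with lam_i absorbs the i-th coordinate of any D, which
   for a quasi-representation p gives p(D) = D(b) p(D') D(d)^-1 as soon as the
   (b, d) entry of p(lam_i) is nonzero; here b and d sit in coordinate i and D'
   is D with that coordinate erased. Taking D = lam_i yields p(lam_i) = lam(g_i),
   and induction on the support of D yields p(D) = D(g). Finally lam_i tends to
   the trivial representation along the cofinite filter: continuity of p forces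
   g to have finite support, and the compact set of the lam_i and their limit
   shows that the bidual is discrete. *)

Require Import Defs.
From mathcomp Require Import all_boot all_order all_algebra all_fingroup.
From mathcomp Require Import gseries spectral generic_quotient.
From mathcomp Require Import all_classical reals topology normedtype.
From mathcomp Require Import finmap complex mxtens.

Set Implicit Arguments.
Unset Strict Implicit.
Unset Printing Implicit Defensive.

Import Order.TTheory GRing.Theory Num.Theory numFieldNormedType.Exports.

Section chu_duality.
Local Open Scope classical_set_scope.
Local Open Scope ring_scope.

(** * Direct sums of groups *)

Section direct_sum_theory.
Variables (H : groupType) (I : choiceType).
Local Notation G := (discrete_topology (direct_sum H I)).
Implicit Types (x y : G) (i j : I) (h k : H).

Lemma direct_sum_eq x y : (forall i, val x i = val y i) -> x = y.
Proof. by move=> xy; apply/val_inj/funext. Qed.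

Lemma val_mulG x y i : val (x * y)%g i = (val x i * val y i)%g.
Proof. by []. Qed.

Lemma val_oneG i : val (1%g : G) i = 1%g.
Proof. by []. Qed.

Lemma single_subproof i h :
  finite_set [set j | (if j == i then h else 1%g) <> 1%g].
Proof.
apply: (@sub_finite_set _ _ [set i]); last exact: finite_set1.
by move=> j /=; case: eqP.
Qed.

Definition single i h : G := DirectSum (@single_subproof i h).

Lemma val_single i h j : val (single i h) j = if j == i then h else 1%g.
Proof. by []. Qed.

Lemma erase_subproof i x :
  finite_set [set j | (if j == i then 1%g else val x j) <> 1%g].
Proof.
apply: sub_finite_set (direct_sumP x) => j /=.
by case: eqP.
Qed.

Definition erase i x : G := DirectSum (@erase_subproof i x).

Lemma val_erase i x j : val (erase i x) j = if j == i then 1%g else val x j.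
Proof. by []. Qed.

Lemma singleM i h k : single i (h * k)%g = (single i h * single i k)%g.
Proof.
apply: direct_sum_eq => j; rewrite val_mulG !val_single.
by case: eqP; rewrite ?mulg1.
Qed.

Lemma single1 i : single i 1%g = 1%g.
Proof. by apply: direct_sum_eq => j; rewrite val_single val_oneG if_same. Qed.

Lemma singleV i h : single i h^-1%g = (single i h)^-1%g.
Proof.
by apply: (mulgI (single i h)); rewrite -singleM !mulgV single1.
Qed.

Lemma single_comm i j h k : i != j ->
  (single i h * single j k = single j k * single i h)%g.
Proof.
move=> ij; apply: direct_sum_eq => l; rewrite !val_mulG !val_single.
by case: (eqVneq l i) => [->|_]; rewrite ?(negPf ij) ?mulg1 ?mul1g.
Qed.

Lemma eraseM i x y : erase i (x * y)%g = (erase i x * erase i y)%g.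
Proof.
apply: direct_sum_eq => j; rewrite val_mulG !val_erase val_mulG.
by case: eqP; rewrite ?mulg1.
Qed.

Lemma single_erase i x : (single i (val x i) * erase i x)%g = x.
Proof.
apply: direct_sum_eq => j; rewrite val_mulG val_single val_erase.
by case: eqP => [->|_]; rewrite ?mulg1 ?mul1g.
Qed.

Lemma erase_single_comm i x h :
  (erase i x * single i h = single i h * erase i x)%g.
Proof.
apply: direct_sum_eq => j; rewrite !val_mulG val_single val_erase.
by case: eqP => _; rewrite ?mulg1 ?mul1g.
Qed.

Lemma erase_single i j h :
  erase i (single j h) = if j == i then 1%g else single j h.
Proof.
apply: direct_sum_eq => l; rewrite val_erase val_single.
have [->|ji] := eqVneq j i; first by case: eqP.
rewrite val_single; case: (eqVneq l i) => [->|//].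
by rewrite eq_sym (negPf ji).
Qed.

(* G is generated by its coordinate subgroups, so most statements about a
   representation of G only have to be checked on [single i h]. *)
Lemma direct_sum_ind (P : G -> Prop) : P 1%g ->
  (forall i h x, P x -> P (single i h * x)%g) -> forall x, P x.
Proof.
move=> P1 PM x.
have [s xs] : exists s : seq I, forall i, i \notin s -> val x i = 1%g.
  have /finite_seqP[s sE] := direct_sumP x; exists s => i /negP si.
  by apply: contra_notP si => xi; move: (xi : [set i | _] i); rewrite sE.
elim: s x xs => [|i s IHs] x xs.
  by rewrite (_ : x = 1%g) //; apply: direct_sum_eq => i; exact: xs.
rewrite -(single_erase i x); apply/PM/IHs => j js; rewrite val_erase.
by case: eqP => // /eqP ji; apply: xs; rewrite inE negb_or ji.
Qed.

End direct_sum_theory.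

Section unitary_theory.
Variables (R : realType) (n : nat).
Implicit Types M N : unitary R n.

Lemma val_unitary1 : val (1%g : unitary R n) = 1%:M.
Proof. by []. Qed.

Lemma unitary_mulV M : val M *m val (M^-1)%g = 1%:M.
Proof. by rewrite -val_unitaryM mulgV. Qed.

Lemma unitary_entry_continuous (i j : 'I_n) :
  continuous (fun M : unitary R n => val M i j).
Proof.
move=> M; have [+ _] := @cvg_unitaryP R n _ (nbhs M) id M _.
by move/(_ (@cvg_id _ (nbhs M))); exact.
Qed.

End unitary_theory.

(** * Finite support of homomorphisms into unitary groups *)

Section support.
Variables (R : realType) (H : finGroupType) (I : choiceType) (n : nat).
Local Notation G := (discrete_topology (direct_sum H I)).
Variable f : G -> unitary R n.
Hypothesis fM : {morph f : x y / (x * y)%g}.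

Lemma morph_one : f 1%g = 1%g.
Proof. by apply: (@mulgI _ (f 1%g)); rewrite -fM !mulg1. Qed.

Lemma morph_inv x : f x^-1%g = (f x)^-1%g.
Proof. by apply: (mulgI (f x)); rewrite -fM !mulgV morph_one. Qed.

Lemma morph_trivial : (forall i h, f (single i h) = 1%g) -> forall x, f x = 1%g.
Proof.
move=> f1; apply: direct_sum_ind => [|i h x fx]; first exact: morph_one.
by rewrite fM f1 fx mulg1.
Qed.

Hypothesis simpleH : simple [set: H]%SET.
Hypothesis nonabelianH : ~~ abelian [set: H]%SET.

(** The kernel of [f] on coordinate [i] is normal in [H] and contains all commutators; it is
    nontrivial as [H] is nonabelian, hence all of [H]. *)
Lemma single_commute_trivial i :
  (forall h k, commute (f (single i h)) (f (single i k))) ->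
  forall h, f (single i h) = 1%g.
Proof.
move=> fC.
pose K := [set h | f (single i h) == 1%g]%SET.
have gK : group_set K.
  apply/group_setP; split; first by rewrite inE single1 morph_one.
  move=> h k; rewrite !inE => /eqP fh /eqP fk.
  by rewrite singleM fM fh fk mulg1.
have nK : (Group gK <| [set: H]%G)%g.
  apply/andP; split; first exact: finset.subsetT.
  apply/fintype.subsetP => h _; rewrite inE.
  apply/fintype.subsetP => _ /imsetP[k kK ->].
  move: kK; rewrite !inE => /eqP fk.
  by rewrite /conjg !singleM !fM fk mul1g -fM -singleM mulVg single1 morph_one.
have [_ /(_ _ nK)[K1|KT]] := simpleP _ simpleH; last first.
  move=> h; have : h \in [set: H]%G by rewrite finset.in_setT.
  by rewrite -KT inE => /eqP.
case/negP: nonabelianH; apply/centsP => h _ k _; apply/commgP/eqP.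
have : [~ h, k]%g \in K.
  rewrite inE commgEl /conjg !singleM !fM !singleV !morph_inv.
  by rewrite -[(f (single i h) * _)%g]fC mulKg mulVg.
by rewrite -[K]/(gval (Group gK)) K1 => /set1gP.
Qed.

(* Noncommuting pairs taken from distinct coordinates are linearly independent:
   the commutator with the second member of a pair kills all other pairs. Hence
   at most n^2 coordinates act nontrivially. *)
Lemma support_finite : exists s : seq I,
  forall i h, i \notin s -> f (single i h) = 1%g.
Proof.
suff /finite_seqP[s sE] : finite_set [set i | exists h, f (single i h) <> 1%g].
  exists s => i h /negP si; apply: contra_notP si => fi.
  have : [set i | exists h, f (single i h) <> 1%g] i by exists h.
  by rewrite sE.
apply: contrapT => infS.
pose A i h := val (f (single i h)).
(* The condition sits under the existential so that [choice] covers every [i]; [(1, 1)] is a dummy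
   where [i] acts trivially. *)
have nc i : exists hk : H * H, (exists h, f (single i h) <> 1%g) ->
    A i hk.1 *m A i hk.2 <> A i hk.2 *m A i hk.1.
  have [[h fh]|] := pselect (exists h, f (single i h) <> 1%g);
    last by exists (1, 1)%g.
  apply: contrapT => /forallNP fC; apply: fh.
  apply: single_commute_trivial => {}h k; apply: contrapT => fhk.
  by apply: (fC (h, k)) => _; rewrite /A /= -!val_unitaryM => /val_inj.
have [hk hkP] := choice nc.
have [B BS cB] := @infinite_set_fset _ _ (n * n).+1 infS.
pose s := in_tuple (enum_fset B).
pose X := [tuple A (tnth s i) (hk (tnth s i)).1 | i < size (enum_fset B)].
suff : free X.
  rewrite /free size_tuple => /eqP dX.
  have := dimvS (subvf <<X>>); rewrite dX dimvf dim_matrix leqNgt => /negP; apply.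
  exact: cB.
apply/freeP => c Xc i; apply/eqP/negPn/negP => ci.
pose a := tnth s i; have aS : exists h, f (single a h) <> 1%g.
  by apply: BS; exact: mem_tnth.
apply: (hkP a aS); set N := A a (hk a).2.
pose C (M : 'M_n) := M *m N - N *m M.
have Xj (j : 'I_(size (enum_fset B))) : C X`_j = if j == i then C X`_i else 0.
  case: eqP => [->//|/eqP ji].
  rewrite -!tnth_nth tnth_mktuple /C /A -!val_unitaryM -!fM.
  rewrite single_comm ?subrr //.
  by rewrite (inj_eq (tuple_uniqP _ _)) //; exact: fset_uniq.
have Xi : X`_i = A a (hk a).1 by rewrite -tnth_nth tnth_mktuple.
move: Xc; clearbody X => Xc;
have : C (\sum_i c i *: X`_i) = 0 by rewrite Xc /C mulmx0 mul0mx subrr.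
rewrite /C mulmx_suml mulmx_sumr -sumrB.
under eq_bigr do rewrite -scalemxAl -scalemxAr -scalerBr -/(C _) Xj.
rewrite (bigD1 i) //= eqxx big1 => [|j /negPf ->]; last by rewrite scaler0.
move=> /eqP; rewrite addr0 scaler_eq0 (negPf ci) /= subr_eq0 => /eqP.
by rewrite Xi.
Qed.
End support.

(** * Irreducible representations are isolated up to equivalence *)

Section schur.
Variables (R : realType) (G : topologicalGroupType) (n : nat).
Variable g : G -> unitary R n.
Hypothesis irrg : irreducible g.

(** An eigenspace of [A] is invariant and nonzero, hence everything. Library eigenvectors are rows,
    so one of [A^T] is transposed. *)
Lemma schur (A : 'M[R[i]]_n) :
  (forall x, A *m val (g x) = val (g x) *m A) -> exists c, A = c%:M.
Proof.
move=> Ag; have [n0 irr] := irrg.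
have [c /eigenvalueP[v vA v0]] := eigenvalue_closed A^T n0; exists c.
pose W := lker (linfun (mulmx (A - c%:M)) : 'Hom('cV[R[i]]_n, 'cV[R[i]]_n)).
have WE w : (w \in W) = ((A - c%:M) *m w == 0) by rewrite memv_ker lfunE.
have vW : v^T \in W.
  rewrite WE mulmxBl mul_scalar_mx subr_eq0; apply/eqP/trmx_inj.
  by rewrite trmx_mul trmxK vA linearZ /= trmxK.
have [x w|W0|WT] := irr W.
- rewrite !WE !mulmxBl !mul_scalar_mx mulmxA Ag -mulmxA => /eqP/subr0_eq ->.
  by rewrite scalemxAr subrr.
- by move: vW; rewrite W0 memv0 -trmx0 (inj_eq trmx_inj) (negPf v0).
- apply/subr0_eq/trmx_inj/row_matrixP => j; rewrite -tr_col trmx0 row0 colE.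
  by apply: (canLR (@trmxK _ _ _)); rewrite trmx0; apply/eqP; rewrite -WE WT memvf.
Qed.

(** By Schur's lemma the adjoint of [T] times [T] is a scalar [c], positive since [T] is nonzero;
    [T] over the square root of [c] is unitary. *)
Lemma unitary_intertwiner (T : 'M[R[i]]_n) : T != 0 ->
  (forall x, map_mx Num.conj T^T *m T *m val (g x) =
    val (g x) *m (map_mx Num.conj T^T *m T)) ->
  exists a (M : unitary R n), a != 0 /\ T = a *: val M.
Proof.
move=> /matrix0Pn[k [j Tkj]] /schur[c cE].
have c0 : 0 < c.
  have -> : c = (map_mx Num.conj T^T *m T) j j by rewrite cE mxE eqxx.
  rewrite mxE (bigD1 k) //= ltr_wpDr //.
    by apply: sumr_ge0 => l _; rewrite !mxE mulrC mul_conjC_ge0.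
  by rewrite !mxE mulrC mul_conjC_gt0.
pose a := sqrtC c; have a0 : 0 < a by rewrite sqrtC_gt0.
have U : a^-1 *: T \is unitarymx.
  apply/unitarymxP/mulmx1C.
  have -> : map_mx Num.conj (a^-1 *: T)^T = a^-1 *: map_mx Num.conj T^T.
    by apply/matrixP => p q; rewrite !mxE rmorphM /= geC0_conj ?invr_ge0 ?ltW.
  rewrite -scalemxAl -scalemxAr cE scalerA -[_%:M]scalemx1.
  rewrite scalerA -expr2 exprVn sqrtCK.
  by rewrite mulVf ?scale1r // gt_eqF.
exists a, (Unitary U); split; first by rewrite gt_eqF.
by rewrite /= scalerA mulfV ?scale1r // gt_eqF.
Qed.
End schur.

(** * Averaging over finitely many coordinates *)

Section averaging.
Variables (R : realType) (H : finGroupType) (I : choiceType) (n : nat).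
Local Notation G := (discrete_topology (direct_sum H I)).
Implicit Types f g : G -> unitary R n.

(** For morphisms this is the unnormalised sum of [f x * g x^-1], with [x] a product of one factor
    from each coordinate in [s]. Nesting the sums isolates one coordinate per step. *)
Fixpoint average f g (s : seq I) : 'M[R[i]]_n := if s is i :: s' then
  \sum_h val (f (single i h)) *m average f g s' *m val (g (single i h^-1%g))
  else 1%:M.

Lemma average_intertwines f g s : {morph f : x y / (x * y)%g} ->
  {morph g : x y / (x * y)%g} -> forall i h, i \in s ->
  val (f (single i h)) *m average f g s = average f g s *m val (g (single i h)).
Proof.
move=> fM gM; elim: s => // j s IHs i h; rewrite inE /= mulmx_sumr mulmx_suml.
have [-> _|ij /= is_] := eqVneq i j.
  (* At the head coordinate, translating the summation variable by [h] moves [h] across. *)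
  rewrite [RHS](reindex_inj (mulgI h)) /=; apply: eq_bigr => k _.
  rewrite -!mulmxA -val_unitaryM -gM -singleM invMg mulgKV !mulmxA.
  by rewrite singleM fM val_unitaryM.
apply: eq_bigr => k _.
rewrite !mulmxA -val_unitaryM -fM single_comm // fM val_unitaryM.
rewrite -(mulmxA (val (f (single j k)))) IHs // -!mulmxA; congr (_ *m (_ *m _)).
by rewrite -!val_unitaryM -!gM single_comm.
Qed.

Lemma average_diag g s : {morph g : x y / (x * y)%g} ->
  average g g s = (#|H| ^ size s)%:R%:M.
Proof.
move=> gM; elim: s => [//|i s IHs] /=; rewrite IHs.
under eq_bigr => h _.
  rewrite -mulmxA mul_scalar_mx -scalemxAr -val_unitaryM -gM -singleM mulgV.
  rewrite single1 morph_one // val_unitary1 scalemx1.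
  over.
by rewrite sumr_const -raddfMn /= -mulrnA expnSr.
Qed.

Lemma cvg_average g s (S : Type) (F : set_system S) (f : S -> G -> unitary R n)
    (f0 : G -> unitary R n) : Filter F ->
  (forall x, (fun t => f t x) @ F --> f0 x) ->
  forall i j, (fun t => average (f t) g s i j) @ F --> average f0 g s i j.
Proof.
move=> FF ff0; elim: s => [|l s IHs] i j; first exact: cvg_cst.
rewrite /= summxE; under eq_fun do rewrite summxE.
apply: cvg_big => [|h _]; first exact: add_continuous.
rewrite mxE; under eq_fun do rewrite mxE.
apply: cvg_big => [|k _]; first exact: add_continuous.
apply: cvgM; last exact: cvg_cst.
rewrite mxE; under eq_fun do rewrite mxE.
apply: cvg_big => [|m _]; first exact: add_continuous.
apply: cvgM; last exact: IHs.
by move/cvg_unitaryP: (ff0 (single l h)); exact.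
Qed.
End averaging.

Section isolation.
Variables (R : realType) (H : finGroupType) (I : choiceType) (n : nat).
Hypothesis simpleH : simple [set: H]%SET.
Hypothesis nonabelianH : ~~ abelian [set: H]%SET.
Local Notation G := (discrete_topology (direct_sum H I)).
Implicit Types f g : G -> unitary R n.

(* The average intertwines f and g on the support s of g, where g is already
   irreducible. Off s, f then acts by scalars, hence trivially since H is perfect. *)
Lemma average_rep_equiv f g s :
  {morph f : x y / (x * y)%g} -> {morph g : x y / (x * y)%g} ->
  irreducible g -> (forall i h, i \notin s -> g (single i h) = 1%g) ->
  average f g s != 0 -> rep_equiv f g.
Proof.
move=> fM gM irrg gs; set T := average f g s => T0.
have fT i h (is_ : i \in s) := average_intertwines fM gM h is_; rewrite -/T in fT.
have Tf i h : i \in s -> map_mx Num.conj T^T *m val (f (single i h)) =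
    val (g (single i h)) *m map_mx Num.conj T^T.
  move=> is_; have /(congr1 (fun M => map_mx Num.conj M^T)) := fT i h^-1%g is_.
  rewrite -/T !trmx_mul !map_mxM -!val_unitaryV -!(morph_inv fM) -!(morph_inv gM).
  by rewrite -!singleV invgK.
move: (map_mx Num.conj T^T) Tf (@unitary_intertwiner _ _ _ _ irrg T T0) => Ts Tf TsP.
(* [Ts *m T] commutes with [g]: on [s] by [fT] and [Tf], off [s] because [g] is trivial there. *)
have [x|a [M [a0 TM]]] := TsP.
  elim/direct_sum_ind: x => [|i h x IHx].
    by rewrite (morph_one gM) val_unitary1 mulmx1 mul1mx.
  rewrite gM val_unitaryM mulmxA -[RHS]mulmxA -IHx mulmxA; congr (_ *m _).
  have [is_|ns] := boolP (i \in s); last first.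
    by rewrite (gs _ _ ns) val_unitary1 mulmx1 mul1mx.
  by rewrite -[LHS]mulmxA -(fT _ _ is_) mulmxA (Tf _ _ is_) -mulmxA.
have fJ i h : i \in s -> (f (single i h) ^ M)%g = g (single i h).
  move=> is_; apply: (mulgI M); rewrite conjgE mulKVg; apply/val_inj.
  rewrite !val_unitaryM; apply: (scalerI a0).
  by rewrite scalemxAr scalemxAl -TM (fT _ _ is_).
have fs i : i \notin s -> forall h, f (single i h) = 1%g.
  move=> ns; apply: single_commute_trivial => // h k.
  pose N l : unitary R n := (f (single i l) ^ M)%g.
  (* Coordinate [i] commutes with those in [s], and [g] is trivial on the others, so Schur's lemma
     applies. *)
  have scal l : exists c, val (N l) = c%:M.
    apply: (schur irrg) => x; rewrite -!val_unitaryM; congr val.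
    elim/direct_sum_ind: x => [|j m x IHx].
      by rewrite morph_one // mulg1 mul1g.
    rewrite gM mulgA -[RHS]mulgA -IHx mulgA.
    apply: (congr1 (fun z => z * g x)%g).
    have [js|js] := boolP (j \in s); last by rewrite gs // mulg1 mul1g.
    rewrite -fJ // -!conjMg -!fM single_comm //.
    by apply: contraNneq ns => ->.
  have [[c cE] [d dE]] := (scal h, scal k).
  have fC : val (N h * N k)%g = val (N k * N h)%g.
    rewrite -[LHS]/(val (N h) *m val (N k)) -[RHS]/(val (N k) *m val (N h)).
    by rewrite cE dE scalar_mxC.
  by apply: (conjg_inj M); rewrite !conjMg; exact: (val_inj fC).
exists M^-1%g; elim/direct_sum_ind => [|i h x IHx].
  by rewrite !morph_one // conj1g.
rewrite fM gM conjMg IHx; apply: (congr1 (fun z => z * _)%g).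
have [is_|ns] := boolP (i \in s); first by rewrite -fJ // conjgK.
by rewrite fs // gs // conj1g.
Qed.

(** A diagonal entry of the average over the support of [D0] is continuous in [D] and nonzero at
    [D0], hence nonzero nearby. *)
Lemma rep_equiv_open (D0 : irrep_ptws R G n) :
  nbhs D0 [set D | rep_equiv (val D) (val D0)].
Proof.
have irrP (D : irrep_ptws R G n) : is_rep (val D) /\ irreducible (val D).
  exact: set_mem (valP D).
have [[_ gM] irrg] := irrP D0.
have [s gs] := support_finite gM simpleH nonabelianH.
have i0 := Ordinal irrg.1.
have cvgD : (fun D : irrep_ptws R G n => average (val D) (val D0) s i0 i0) @ D0
    --> average (val D0) (val D0) s i0 i0.
  apply: (@cvg_average _ _ _ _ _ _ _ (nbhs D0) (fun D => val D) _
    (nbhs_filter D0)) => x.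
  have cval : continuous
      (fun D : irrep_ptws R G n => val D : {ptws G -> unitary R n}).
    exact: initial_continuous.
  have cx : continuous (fun f : {ptws G -> unitary R n} => f x).
    exact: (@proj_continuous G (fun=> unitary R n) x).
  exact: (cvg_comp _ _ (cval D0) (cx _)).
have D00 : average (val D0) (val D0) s i0 i0 != 0.
  rewrite average_diag // mxE eqxx pnatr_eq0 -lt0n expn_gt0.
  by rewrite -cardsT cardG_gt0.
apply: filterS (cvgr_neq0 _ cvgD D00) => D /= Ds.
have [[_ fM] _] := irrP D.
apply: (average_rep_equiv fM gM irrg gs).
by apply: contraNneq Ds => ->; rewrite mxE.
Qed.

Lemma dual_ptws_discrete (A : set (dual_ptws R G n)) : open A.
Proof.
have piE (D D0 : irrep_ptws R G n) : rep_equiv (val D) (val D0) ->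
    \pi_(dual_ptws R G n)%qT D = \pi_(dual_ptws R G n)%qT D0.
  by move=> DD0; apply/eqmodP/asboolP.
suff : open (\pi_(dual_ptws R G n)%qT @^-1` A) by [].
rewrite openE => D0 /= AD0.
by apply: filterS (rep_equiv_open D0) => D /piE /= ->.
Qed.
End isolation.

(** * Absorbing a coordinate into the regular representation *)

Section controlled_unitary.
Variables (R : realType) (n m : nat).
Implicit Types V : 'I_m -> 'M[R[i]]_n.

Lemma sum_mxtens_index (F : 'I_(n * m) -> R[i]) :
  \sum_r F r = \sum_a \sum_b F (mxtens_index (a, b)).
Proof.
rewrite pair_big /= (reindex (@mxtens_index n m)) /=.
  by apply: eq_bigr => -[].
by exists (@mxtens_unindex n m) => r _; rewrite (mxtens_indexK, mxtens_unindexK).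
Qed.

(* The operator v (x) e_b |-> V b v (x) e_b. *)
Definition controlled V : 'M[R[i]]_(n * m) := \matrix_(r, c)
  (((@mxtens_unindex n m r).2 == (@mxtens_unindex n m c).2)%:R *
   V (@mxtens_unindex n m c).2 (@mxtens_unindex n m r).1 (@mxtens_unindex n m c).1).

Lemma controlledE V a b c d :
  controlled V (mxtens_index (a, b)) (mxtens_index (c, d)) = (b == d)%:R * V d a c.
Proof. by rewrite mxE !mxtens_indexK. Qed.

Lemma tensmx_controlled V (A : 'M_n) (B : 'M_m) a b c d :
  (tensmx A B *m controlled V) (mxtens_index (a, b)) (mxtens_index (c, d)) =
  (A *m V d) a c * B b d.
Proof.
rewrite !mxE sum_mxtens_index mulr_suml; apply: eq_bigr => k _.
rewrite (bigD1 d) //= big1 => [|l /negPf ld].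
  by rewrite tensmxE controlledE eqxx mul1r addr0 mulrAC.
by rewrite controlledE ld mul0r mulr0.
Qed.

Lemma controlled_tensmx V (A : 'M_n) (B : 'M_m) a b c d :
  (controlled V *m tensmx A B) (mxtens_index (a, b)) (mxtens_index (c, d)) =
  (V b *m A) a c * B b d.
Proof.
rewrite !mxE sum_mxtens_index mulr_suml; apply: eq_bigr => k _.
rewrite (bigD1 b) //= big1 => [|l /negPf ld].
  by rewrite tensmxE controlledE eqxx mul1r addr0 mulrA.
by rewrite controlledE eq_sym ld !mul0r.
Qed.

Lemma controlled_unitary (V : 'I_m -> unitary R n) :
  controlled (fun a => val (V a)) \is unitarymx.
Proof.
apply/unitarymxP/matrixP => r r'.
case: (mxtens_indexP r) (mxtens_indexP r') => a b [c d].
rewrite !mxE sum_mxtens_index (can_eq (@mxtens_indexK _ _)) xpair_eqE.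
transitivity ((b == d)%:R * (val (V b) *m val (V b)^-1%g) a c).
  rewrite !mxE mulr_sumr; apply: eq_bigr => k _.
  rewrite (bigD1 b) //= big1 => [|l /negPf ld].
    rewrite controlledE !mxE !mxtens_indexK /= eqxx mul1r addr0.
    by rewrite rmorphM /= rmorph_nat mulrCA eq_sym.
  by rewrite controlledE eq_sym ld !mul0r.
by rewrite -val_unitaryM mulgV val_unitary1 mxE -natrM mulnb andbC.
Qed.
End controlled_unitary.

(** * The regular representation of [H] *)

Section regular_representation.
Variables (R : realType) (H : finGroupType) (m : nat).
Variables (e : 'I_m -> H) (e' : H -> 'I_m).
Hypotheses (eK : cancel e e') (e'K : cancel e' e).

(** The permutation matrix of left translation by [h], in the basis numbered by [e]. *)
Definition regular_mx h : 'M[R[i]]_m :=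
  \matrix_(a, b) (e a == h * e b)%g%:R.

Lemma regular_mxM h k : regular_mx (h * k)%g = regular_mx h *m regular_mx k.
Proof.
apply/matrixP => a c; rewrite !mxE (bigD1 (e' (k * e c)%g)) //= big1 => [|b bc].
  by rewrite !mxE e'K eqxx mulr1 addr0 mulgA.
rewrite !mxE [(e b == _)%g]negbTE ?mulr0 //.
by apply: contraNneq bc => <-; rewrite eK.
Qed.

Lemma regular_mx1 : regular_mx 1%g = 1%:M.
Proof. by apply/matrixP => a b; rewrite !mxE mul1g (can_eq eK). Qed.

Lemma regular_mx_unitary h : regular_mx h \is unitarymx.
Proof.
apply/unitarymxP; rewrite -[RHS]regular_mx1 -(mulgV h) regular_mxM.
congr (_ *m _); apply/matrixP => a b; rewrite !mxE rmorph_nat.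
congr (nat_of_bool _)%:R; apply/eqP/eqP => [->|->]; first by rewrite mulKg.
by rewrite mulKVg.
Qed.

Definition regular h : unitary R m := Unitary (regular_mx_unitary h).

Lemma regularM : {morph regular : h k / (h * k)%g}.
Proof. by move=> h k; apply/val_inj; exact: regular_mxM. Qed.

(** Left translation by a nontrivial element has no fixed point. *)
Lemma regular_diag h a : val (regular h) a a != 0 -> h = 1%g.
Proof.
rewrite /= mxE pnatr_eq0 eqb0 negbK eq_sym -{2}[e a]mul1g.
by move=> /eqP/mulIg.
Qed.

Lemma regular1 : regular 1%g = 1%g.
Proof. by apply/val_inj; exact: regular_mx1. Qed.

Lemma regularV h : regular h^-1%g = (regular h)^-1%g.
Proof. by apply: (mulgI (regular h)); rewrite -regularM !mulgV regular1. Qed.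

Lemma regular_inj : injective regular.
Proof.
move=> h k /(congr1 (fun M : unitary R m => val M (e' k) (e' 1%g))) /=.
rewrite !mxE !e'K !mulg1 eqxx => /eqP.
by rewrite eqr_nat eqb1 => /eqP.
Qed.
End regular_representation.

(** * Quasi-representations of the direct sum *)

Section cofinite.
Variable I : choiceType.

Definition cofinite : set_system I := [set A | finite_set (~` A)].

Lemma cofinite_filter : Filter cofinite.
Proof.
split=> [|A B cA cB|A B AB cA]; rewrite /cofinite /=.
- by rewrite setCT.
- by rewrite setCI finite_setU.
- by apply: sub_finite_set cA; exact: subsetC.
Qed.

(** A neighbourhood of the limit misses [f i] for only finitely many [i], and finite sets are
    compact. *)
Lemma cofinite_cvg_compact (T : topologicalType) (f : I -> T) (a : T) :
  f @ cofinite --> a -> compact (a |` range f).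
Proof.
move=> fa; apply/compact_near_coveringP => J F P FF KP.
have [[A B] [/= nA FB] AB] := KP a (or_introl erefl).
have /finite_compact/compact_near_coveringP cC : finite_set (f @` ~` (f @^-1` A)).
  by apply: finite_image; exact: fa.
have FC : \forall j \near F, (f @` (~` (f @^-1` A))) `<=` P j.
  by apply: cC => _ [i _ <-]; apply: KP; right; exists i.
apply: filterS2 FB FC => j Bj Cj _ [->|[i _ <-]].
  by apply: (AB (a, j)); split=> //; exact: nbhs_singleton.
have [Ai|Ai] := pselect (A (f i)); first exact: (AB (f i, j)).
by apply: Cj; exists i.
Qed.
End cofinite.

Section reflexivity.
Variables (R : realType) (H : finGroupType) (I : choiceType).
Local Notation G := (discrete_topology (direct_sum H I)).
Local Notation U := (unitary R).
Implicit Types (i : I) (x : G).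

Lemma discrete_rep n (f : G -> U n) : {morph f : x y / (x * y)%g} -> is_rep f.
Proof.
move=> fM; split=> // x A /nbhs_singleton Ax.
by apply: (filterS _ (@discrete_set1 G x)) => y ->.
Qed.

Lemma rep_eq n (D D' : rep R G n) : (forall x, D x = D' x) -> D = D'.
Proof. by move=> DD'; apply/val_inj/funext. Qed.

Lemma repM n (D : rep R G n) : {morph D : x y / (x * y)%g}.
Proof. by have [] := repP D. Qed.

Lemma trivial_subproof n : {morph (fun _ : G => 1%g : U n) : x y / (x * y)%g}.
Proof. by move=> x y; rewrite mulg1. Qed.

Definition trivial_rep n : rep R G n := Rep (discrete_rep (@trivial_subproof n)).

Lemma erase_rep_subproof n i (D : rep R G n) :
  {morph (fun x => D (erase i x)) : x y / (x * y)%g}.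
Proof. by move=> x y; rewrite eraseM repM. Qed.

Definition erase_rep n i (D : rep R G n) : rep R G n :=
  Rep (discrete_rep (erase_rep_subproof i D)).

(** In dimension 1 the trivial representation is its own tensor square, so its value is a nonzero
    idempotent scalar. Direct sums give the other dimensions. *)
Lemma quasi_rep_trivial (p : chu_bidual R G) n : p n (trivial_rep n.+1) = 1%g.
Proof.
have [_ pD pT _] := quasi_repP p.
have p1 : p 0%N (trivial_rep 1) = 1%g.
  have := pT 0%N 0%N (trivial_rep 1) (trivial_rep 1).
  have -> : tens (trivial_rep 1) (trivial_rep 1) = trivial_rep (1 * 1).
    by apply: rep_eq => x; exact: tensU1.
  set a : U 1 := p 0%N (trivial_rep 1) => aa.
  have a0 : val a ord0 ord0 != 0.
    apply/eqP => a0; have := unitary_mulV a => /matrixP/(_ ord0 ord0).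
    rewrite !mxE big_ord1 a0 mul0r => /eqP.
    by rewrite eq_sym oner_eq0.
  have : val a ord0 ord0 = val a ord0 ord0 * val a ord0 ord0.
    rewrite -(tensmxE (val a) (val a)).
    have -> : mxtens_index (ord0 : 'I_1, ord0 : 'I_1) = ord0 by apply: val_inj.
    exact: (congr1 (fun M : U 1 => val M ord0 ord0) aa).
  move=> /(congr1 (fun z => (val a ord0 ord0)^-1 * z)).
  rewrite mulVf // mulKf // => a1; apply/val_inj/matrixP => r c.
  by rewrite !ord1 -a1 val_unitary1 mxE.
elim: n => [//|n IHn].
have := pD 0%N n (trivial_rep 1) (trivial_rep n.+1); rewrite p1 IHn dsumU1.
have -> // : dsum (trivial_rep 1) (trivial_rep n.+1) = trivial_rep n.+2.
by apply: rep_eq => x; exact: dsumU1.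
Qed.

(** * Recovering a group element from the regular representations *)

Section coordinate.
Variables (m : nat) (e : 'I_m.+1 -> H) (e' : H -> 'I_m.+1).
Hypotheses (eK : cancel e e') (e'K : cancel e' e).

Lemma regular_rep_subproof i :
  {morph (fun x : G => regular R eK e'K (val x i)) : x y / (x * y)%g}.
Proof. by move=> x y; rewrite val_mulG regularM. Qed.

Definition regular_rep i : rep R G m.+1 :=
  Rep (discrete_rep (regular_rep_subproof i)).

(* D and its restriction [erase_rep i D] become equivalent after tensoring with
   the i-th regular representation, through the unitary
   v (x) e_h |-> D (single i h) v (x) e_h; compare matrix entries of p on both. *)
Lemma quasi_rep_erase (p : chu_bidual R G) n (D : rep R G n.+1) i a b :
  val (p m (regular_rep i)) a b != 0 ->
  p n D = (D (single i (e a)) * p n (erase_rep i D) * (D (single i (e b)))^-1)%g.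
Proof.
move=> pab; have [_ _ pT pJ] := quasi_repP p.
pose V c := D (single i (e c)).
pose W : U (n.+1 * m.+1) := Unitary (controlled_unitary V).
have DW : tens (erase_rep i D) (regular_rep i) =
    conj_rep (tens D (regular_rep i)) W.
  apply: rep_eq => x; apply: (mulgI W).
  rewrite -[RHS]/(W * (tens D (regular_rep i) x ^ W))%g conjgE mulKVg.
  apply/val_inj; rewrite !val_unitaryM.
  apply/matrixP => r c.
  case: (mxtens_indexP r) (mxtens_indexP c) => k h [l h'].
  rewrite tensmx_controlled controlled_tensmx.
  have -> : val (regular_rep i x) h h' = (e h == val x i * e h')%g%:R by rewrite mxE.
  (* Where the entry is nonzero, the block [V h] supplies the factor [single i (val x i)] missing
     from [erase i x]. *)
  case: eqP => [eh|_]; last by rewrite !mulr0.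
  rewrite !mulr1; congr (_ k l).
  rewrite -!val_unitaryM /V -!repM eh singleM -mulgA.
  by rewrite -erase_single_comm mulgA single_erase.
have pW : (W * tensU (p n (erase_rep i D)) (p m (regular_rep i)) =
    tensU (p n D) (p m (regular_rep i)) * W)%g.
  rewrite -!pT DW; have -> := pJ _ (tens D (regular_rep i)) W.
  by rewrite conjgE mulKVg.
have VpV : (V a * p n (erase_rep i D) = p n D * V b)%g.
  apply/val_inj/matrixP => k l; apply: (mulIf pab).
  have -> : val (V a * p n (erase_rep i D))%g k l * val (p m (regular_rep i)) a b =
      val (W * tensU (p n (erase_rep i D)) (p m (regular_rep i)))%g
        (mxtens_index (k, a)) (mxtens_index (l, b)).
    by rewrite !val_unitaryM controlled_tensmx.
  rewrite pW !val_unitaryM tensmx_controlled //.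
by rewrite -/(V a) VpV mulgK.
Qed.

(** A unitary matrix has a nonzero entry, so [quasi_rep_erase] applies to [regular_rep i] itself,
    whose erasure is trivial. *)
Lemma quasi_rep_regular (p : chu_bidual R G) i :
  exists h, p m (regular_rep i) = regular R eK e'K h.
Proof.
have /matrix0Pn[a [b pab]] : val (p m (regular_rep i)) != 0.
  apply/eqP => p0; have := unitary_mulV (p m (regular_rep i)).
  rewrite p0 mul0mx => /matrixP/(_ ord0 ord0)/eqP.
  by rewrite !mxE eq_sym oner_eq0.
exists (e a * (e b)^-1)%g; rewrite (quasi_rep_erase _ pab).
have -> : erase_rep i (regular_rep i) = trivial_rep m.+1.
  apply: rep_eq => x; rewrite -[LHS]/(regular _ _ _ (val (erase i x) i)).
  by rewrite val_erase eqxx regular1.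
rewrite quasi_rep_trivial mulg1 -(morph_inv (@repM _ _)) -repM -singleV -singleM.
by rewrite -[LHS]/(regular _ _ _ (val (single i _) i)) val_single eqxx.
Qed.

(** As [x] has finite support, [regular_rep i x] is 1 for all but finitely many [i]; near coverings
    pass from points to compact sets, since points of [G] are open. *)
Lemma cvg_regular_rep : regular_rep @ @cofinite I --> trivial_rep m.+1.
Proof.
have FF := @cofinite_filter I.
move=> B [_ [[C oC <-] /= C1] CB]; apply: (filterS CB).
have := @compact_open_cvgP G (U m.+1)
  ((fun i => val (regular_rep i)) @ @cofinite I) (val (trivial_rep m.+1)) _.
move=> [_ cvgC]; apply: cvgC; last exact: open_nbhs_nbhs.
move=> K O cK oO KO.
have nK : near_covering K by exact/compact_near_coveringP.
suff : \forall i \near @cofinite I, K `<=` (fun x => O (regular_rep i x)).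
  by apply: filterS => i KOi _ [x Kx <-]; exact: KOi.
apply: nK => x Kx.
exists ([set x], [set i | val x i = 1%g]).
  split; first exact: (@discrete_set1 G x).
  exact: direct_sumP.
move=> [y i] /= [-> xi].
rewrite -[regular_rep i x]/(regular _ _ _ (val x i)) (xi : val x i = 1%g) regular1.
by apply: KO; exists x.
Qed.

(** An open neighbourhood of 1 that contains a matrix of the regular representation only if it is
    that of 1. *)
Definition nonzero_diag a : set (U m.+1) := [set M : U m.+1 | val M a a != 0].

Lemma nonzero_diag_open a : open (nonzero_diag a).
Proof.
rewrite openE => M Maa.
exact: (cvgr_neq0 _ (@unitary_entry_continuous R m.+1 a a M) Maa).
Qed.

Lemma quasi_rep_finite (p : chu_bidual R G) (g : I -> H) :
  (forall i, p m (regular_rep i) = regular R eK e'K (g i)) ->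
  finite_set [set i | g i <> 1%g].
Proof.
move=> pg; have [/sum_fun_continuousP cp _ _ _] := quasi_repP p.
have /(_ (nonzero_diag ord0)) := cvg_comp _ _ cvg_regular_rep (cp m _).
rewrite quasi_rep_trivial => cofO.
have /cofO : nbhs (1%g : U m.+1) (nonzero_diag ord0).
  apply: open_nbhs_nbhs; split; first exact: nonzero_diag_open.
  by rewrite /nonzero_diag /= mxE eqxx oner_neq0.
apply: sub_finite_set => i /= gi pi; apply: gi.
by move: pi; rewrite /= pg => /regular_diag.
Qed.

Hypothesis simpleH : simple [set: H]%SET.
Hypothesis nonabelianH : ~~ abelian [set: H]%SET.

Lemma chu_eval_surj (p : chu_bidual R G) : exists x : G, chu_eval R x = p.
Proof.
have [g pg] := choice (quasi_rep_regular p).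
pose x : G := DirectSum (quasi_rep_finite pg).
have xE i : val x i = g i by [].
exists x; apply/val_inj/functional_extensionality_dep => n; apply/funext => D.
have [s Ds] := support_finite (@repM _ D) simpleH nonabelianH.
rewrite -[LHS]/(D x) -[RHS]/(p n D).
elim: s D Ds => [|i s IHs] D Ds.
  have -> : D = trivial_rep n.+1.
    apply: rep_eq => y; rewrite -[RHS]/(1%g).
    by apply: (morph_trivial (@repM _ D)) => i h; exact: Ds.
  by rewrite quasi_rep_trivial.
(* With this entry, [quasi_rep_erase] has left factor [D (single i (g i))] and a trivial right
   factor. *)
have pab : val (p m (regular_rep i)) (e' (g i)) (e' 1%g) != 0.
  by rewrite pg mxE !e'K mulg1 eqxx oner_neq0.
rewrite (quasi_rep_erase _ pab) !e'K single1 (morph_one (@repM _ D)) invg1 mulg1.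
rewrite -IHs => [|j h js].
  by rewrite -[erase_rep i D x]/(D (erase i x)) -repM -xE single_erase.
rewrite -[LHS]/(D (erase i (single j h))) erase_single.
have [_|ji] := eqVneq j i; first by rewrite (morph_one (@repM _ D)).
by apply: Ds; rewrite inE negb_or ji.
Qed.

Lemma regular_rep_eval (x : G) i :
  chu_eval R x m (regular_rep i) = regular R eK e'K (val x i).
Proof. by []. Qed.

Lemma chu_eval_inj : injective (@chu_eval R G).
Proof.
move=> x y xy; apply: direct_sum_eq => i.
by apply: (@regular_inj R _ _ _ _ eK e'K); rewrite -!regular_rep_eval xy.
Qed.

Lemma regular_reps_compact :
  compact (trivial_rep m.+1 |` range regular_rep).
Proof. exact/cofinite_cvg_compact/cvg_regular_rep. Qed.

(** Compactness of the regular representations with their limit makes the condition for all [i] at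
    once a compact-open neighbourhood. *)
Lemma nonzero_diag_nbhs1 : nbhs (1%g : chu_bidual R G)
  [set q | forall i, nonzero_diag ord0 (q m (regular_rep i))].
Proof.
pose K := existT (fun n => rep R G n.+1) m @`
  (trivial_rep m.+1 |` range regular_rep).
pose O := existT (fun n => U n.+1) m @` nonzero_diag ord0.
have cK : compact K.
  apply: continuous_compact regular_reps_compact.
  apply: continuous_subspaceT.
  exact: (@existT_continuous nat (fun n => rep R G n.+1) m).
have oO : open O.
  exact: (@existT_open_map nat (fun n => U n.+1) m _ (nonzero_diag_open ord0)).
have : nbhs (1%g : chu_bidual R G) [set q | sum_fun q @` K `<=` O].
  apply: (@initial_continuous (chu_bidual R G)
    {compact-open, chu_dual R G -> unitary_sum R}
    (fun p : chu_bidual R G => sum_fun p)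
    1%g [set f : {compact-open, _ -> _} | f @` K `<=` O]).
  apply: open_nbhs_nbhs; split; first exact: compact_open_open.
  move=> _ [_ [D _ <-] <-]; exists 1%g => //.
  by rewrite /nonzero_diag /= mxE eqxx oner_neq0.
apply: filterS => q qK i.
have [|M OM] := qK (sum_fun q (existT _ m (regular_rep i))).
  exists (existT _ m (regular_rep i)) => //.
  by exists (regular_rep i) => //; right; exists i.
by move/(@existT_inj2 _ (fun n => U n.+1)) => <-.
Qed.

Lemma chu_reflexive_coordinate : chu_reflexive R G.
Proof.
have [f fK] := choice chu_eval_surj.
split.
  move=> x y; apply/val_inj/functional_extensionality_dep => n; apply/funext => D.
  exact: repM.
exists f; first by split=> // x; apply: chu_eval_inj; exact: fK.
split.
  move=> x A /nbhs_singleton Ax.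
  by apply: (filterS _ (@discrete_set1 G x)) => y ->.
(* The inverse [f] is locally constant: for [q] near [p], [q * p^-1] lies in the neighbourhood of 1
   above, so [f q] and [f p] agree in every coordinate. *)
move=> p A /nbhs_singleton /= Ap.
have cdiv : {for p, continuous (fun q : chu_bidual R G => (q * p^-1)%g)}.
  by apply: (cvg_comp2 cvg_id (cvg_cst (p^-1)%g) (mulg_cts (p, p^-1%g))).
have nq : nbhs (p * p^-1)%g
    [set q : chu_bidual R G | forall i, nonzero_diag ord0 (q m (regular_rep i))].
  by rewrite mulgV; exact: nonzero_diag_nbhs1.
apply: (@filterS _ (nbhs p) _ _ _ _ (cdiv _ nq)) => q /= qp.
suff -> : f q = f p by [].
apply: direct_sum_eq => i; apply: (mulIg (val (f p) i)^-1%g); rewrite mulgV.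
have fE (r : chu_bidual R G) : r m (regular_rep i) = regular R eK e'K (val (f r) i).
  by rewrite -{1}(fK r).
have := qp i.
rewrite -[bidual_fun _ _]/(bidual_fun q (regular_rep i) *
  (bidual_fun p (regular_rep i))^-1)%g !fE.
rewrite -regularV -regularM; exact: regular_diag.
Qed.
End coordinate.

Lemma chu_reflexive_direct_sum : simple [set: H]%SET -> ~~ abelian [set: H]%SET ->
  chu_reflexive R G.
Proof.
(* Index [m] stands for dimension [m.+1], hence the predecessor of the order of [H]. *)
have H0 : #|H|.-1.+1 = #|H| by rewrite prednK // -cardsT cardG_gt0.
apply: (@chu_reflexive_coordinate #|H|.-1 (fun a => enum_val (cast_ord H0 a))
  (fun h => cast_ord (esym H0) (enum_rank h))) => [a|h].
  by rewrite enum_valK cast_ordK.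
by rewrite cast_ordKV enum_rankK.
Qed.
End reflexivity.
End chu_duality.

Theorem theorem4p1 (R : realType) (H : finGroupType) (I : Type)
    (simpleH : simple [set: H]%SET)
    (nonabelianH : ~~ abelian [set: H]%SET)
    (infiniteI : infinite_set [set: I]%classic) :
  chu_reflexive R (discrete_topology (direct_sum H I)) /\
  forall (n : nat) (A : set (dual_ptws R (discrete_topology (direct_sum H I)) n)),
    open A.
Proof.
(* [{classic I}] endows [I] with a choice structure. *)
split; first exact: (@chu_reflexive_direct_sum R H {classic I}).
by move=> n A; exact: (@dual_ptws_discrete R H {classic I}).
Qed.
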